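(* Let $D=(V,A)$ be a $2$-arc-strong semicomplete digraph. For every arc $a\in A$ there exists a spanning eulerian subdigraph of $D$ containing $a$.
   Context: Digraphs are finite, with no loops and no parallel arcs (two opposite arcs $xy$, $yx$ are allowed). A digraph is semicomplete if it has no pair of non-adjacent vertices, i.e. for any two distinct vertices $x,y$ at least one of $xy,yx$ is an arc. A digraph is strong if it contains an $(s,t)$-path for each ordered pair of distinct vertices $s,t$. A digraph $D=(V,A)$ is $k$-arc-strong if $D\setminus A'$ is strong for every $A'\subseteq A$ with at most $k-1$ arcs. A digraph is eulerian if it is connected (its underlying undirected graph is connected) and every vertex has in-degree equal to out-degree. A subdigraph of $D$ is spanning if its vertex set is $V(D)$. *)

(* Defs.v *)
From mathcomp Require Import all_boot.

Set Implicit Arguments.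
Unset Strict Implicit.
Unset Printing Implicit Defensive.

Record digraph (V : finType) := Digraph {
  arcs : {set V * V};
  arcs_loopless : forall x : V, (x, x) \notin arcs
}.

Definition arc (V : finType) (D : digraph V) : rel V :=
  fun x y => (x, y) \in arcs D.

Definition semicomplete (V : finType) (D : digraph V) : Prop :=
  forall x y : V, x != y -> arc D x y || arc D y x.

Definition strong (V : finType) (D : digraph V) : Prop :=
  forall s t : V, s != t -> connect (arc D) s t.

Lemma del_arcs_loopless (V : finType) (D : digraph V) (B : {set V * V}) :
  forall x : V, (x, x) \notin arcs D :\: B.
Proof.
by move=> x; rewrite in_setD (negbTE (arcs_loopless D x)) andbF.
Qed.

Definition del_arcs (V : finType) (D : digraph V) (B : {set V * V}) :
  digraph V := Digraph (del_arcs_loopless D B).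

Definition arc_strong (k : nat) (V : finType) (D : digraph V) : Prop :=
  forall B : {set V * V}, B \subset arcs D -> #|B| < k ->
    strong (del_arcs D B).

Definition out_degree (V : finType) (D : digraph V) (x : V) : nat :=
  #|[set y | arc D x y]|.

Definition in_degree (V : finType) (D : digraph V) (x : V) : nat :=
  #|[set y | arc D y x]|.

Definition connected (V : finType) (D : digraph V) : Prop :=
  forall s t : V, connect (fun x y => arc D x y || arc D y x) s t.

Definition eulerian (V : finType) (D : digraph V) : Prop :=
  connected D /\ forall x : V, in_degree D x = out_degree D x.

(* Both digraphs have the whole of V as vertex set, so a subdigraph of D
   living on V is spanning as soon as its arcs are arcs of D. *)
Definition spanning_subdigraph (V : finType) (H D : digraph V) : Prop :=
  arcs H \subset arcs D.

(* Main.v *)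
Require Import Defs.
From mathcomp Require Import all_boot.

Set Implicit Arguments.
Unset Strict Implicit.
Unset Printing Implicit Defensive.

(** Take a connected balanced arc set [H] containing [a] whose support [S] has
    maximum size, and suppose that some [x] lies outside [S].  Any cycle that is
    arc-disjoint from [H] and has an arc between [S] and its complement could be
    added to [H]; so, with [G] the arcs of [D] not in [H], no such arc lies on a
    cycle of [G].  Let [T] be the out-neighbours of [x] in [S]; by
    semicompleteness, [S \ T] consists of in-neighbours of [x].  An arc [st] of
    [H] other than [a] from [S \ T] to [T] could be replaced by the path [sxt],
    so [a] is the only possible one and, [H] being balanced, the set [B] of arcs
    of [H] leaving [T] has at most one element.  If [T] is nonempty, the set of
    vertices reachable from [T] in [G] contains neither [x] nor a vertex of
    [S \ T], so it is closed under the arcs of [D - B], which contradicts the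
    strong connectivity of [D - B].  If [T] is empty, then [x] cannot reach [S]
    in [D]. *)

(** * Arc sets: support, balance, connectivity, cuts and cycles *)

Section ArcSets.

Variable V : finType.
Implicit Types (H C : {set V * V}) (x y s t : V).

Definition arc_rel H : rel V := fun x y => (x, y) \in H.

Definition adj_rel H : rel V := fun x y => ((x, y) \in H) || ((y, x) \in H).

Definition support H : {set V} := [set e.1 | e in H] :|: [set e.2 | e in H].

(** Degrees are written as sums over arcs, so that disjoint unions and exchanges of single arcs
    become identities between sums. *)
Definition balanced H : bool :=
  [forall x, \sum_(e in H) (e.1 == x) == \sum_(e in H) (e.2 == x)].

(** Connectivity relative to the support, since an arc set under construction may miss vertices of
    [V]. *)
Definition rooted H x : bool :=
  [forall y in support H, connect (adj_rel H) x y].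

Lemma balancedP H :
  reflect (forall x, \sum_(e in H) (e.1 == x) = \sum_(e in H) (e.2 == x))
          (balanced H).
Proof. exact: 'forall_eqP. Qed.

Lemma support_fst H x y : (x, y) \in H -> x \in support H.
Proof. by move=> xyH; rewrite inE; apply/orP; left; exact: (imset_f fst xyH). Qed.

Lemma support_snd H x y : (x, y) \in H -> y \in support H.
Proof. by move=> xyH; rewrite inE; apply/orP; right; exact: (imset_f snd xyH). Qed.

Lemma supportP H x :
  reflect (exists y, ((x, y) \in H) || ((y, x) \in H)) (x \in support H).
Proof.
apply: (iffP idP) => [|[y /orP[/support_fst|/support_snd]]] //.
by case/setUP=> /imsetP[[y z] yzH ->]; [exists z | exists y]; rewrite yzH ?orbT.
Qed.

Lemma supportU H C : support (H :|: C) = support H :|: support C.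
Proof. by rewrite /support !imsetU setUACA. Qed.

Lemma adj_sym H : connect_sym (adj_rel H).
Proof. by apply: sym_connect_sym => x y; rewrite /adj_rel orbC. Qed.

Lemma adj_connectS H C x y :
  H \subset C -> connect (adj_rel H) x y -> connect (adj_rel C) x y.
Proof.
move=> /subsetP sHC; apply: connect_sub => {}x {}y xyH; apply: connect1.
by case/orP: xyH => /sHC xyC; rewrite /adj_rel xyC ?orbT.
Qed.

Lemma sum_fst_deg H x : \sum_(e in H) (e.1 == x) = #|[set y | (x, y) \in H]|.
Proof.
have injp : injective (pair x : V -> V * V) by move=> y z [].
rewrite -(card_imset _ injp) -sum1_card big_mkcond [RHS]big_mkcond /=.
apply: eq_bigr => -[u v] _ /=.
have -> : ((u, v) \in [set (x, y) | y in [set y | (x, y) \in H]])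
          = ((u, v) \in H) && (u == x).
  apply/imsetP/andP => [[y]|[uvH /eqP eux]].
    by rewrite inE => xyH [-> ->].
  by exists v; rewrite ?inE -eux.
by case: (_ \in H); case: (u == x).
Qed.

Lemma sum_snd_deg H x : \sum_(e in H) (e.2 == x) = #|[set y | (y, x) \in H]|.
Proof.
have injp : injective (fun y => (y, x) : V * V) by move=> y z [].
rewrite -(card_imset _ injp) -sum1_card big_mkcond [RHS]big_mkcond /=.
apply: eq_bigr => -[u v] _ /=.
have -> : ((u, v) \in [set (y, x) | y in [set y | (y, x) \in H]])
          = ((u, v) \in H) && (v == x).
  apply/imsetP/andP => [[y]|[uvH /eqP evx]].
    by rewrite inE => xyH [-> ->].
  by exists u; rewrite ?inE -evx.
by case: (_ \in H); case: (v == x).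
Qed.

Lemma balancedU H C :
  [disjoint H & C] -> balanced H -> balanced C -> balanced (H :|: C).
Proof.
move=> dHC /balancedP bH /balancedP bC; apply/balancedP => x.
have sumU (f : V * V -> nat) :
    \sum_(e in H :|: C) f e = \sum_(e in H) f e + \sum_(e in C) f e.
  by rewrite -bigU //; apply: eq_bigl => e; rewrite !inE.
by rewrite !sumU bH bC.
Qed.

(** Summing the balance condition over [X] counts each arc inside [X] once on either side; what
    remains are the two cuts. *)
Lemma balanced_cut H (X : {set V}) : balanced H ->
  #|[set e in H | (e.1 \in X) && (e.2 \notin X)]|
  = #|[set e in H | (e.1 \notin X) && (e.2 \in X)]|.
Proof.
move=> /balancedP bH.
have sumX (f : V * V -> V) :
    \sum_(x in X) \sum_(e in H) (f e == x) = \sum_(e in H) (f e \in X).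
  rewrite exchange_big /=; apply: eq_bigr => e _.
  have [fX|fX] := boolP (f e \in X).
    rewrite (bigD1 (f e)) //= eqxx big1 // => x /andP[_ /negPf].
    by rewrite eq_sym => ->.
  rewrite big1 // => x xX; case: eqP => // fex.
  by rewrite fex xX in fX.
have cardE (P : pred (V * V)) : #|[set e in H | P e]| = \sum_(e in H) P e.
  rewrite -sum1_card big_mkcond [RHS]big_mkcond /=.
  by apply: eq_bigr => e _; rewrite inE; case: (e \in H); case: (P e).
have cutE : \sum_(e in H) (e.1 \in X) = \sum_(e in H) (e.2 \in X).
  by rewrite -(sumX fst) -(sumX snd); apply: eq_bigr => x _; exact: bH.
rewrite !cardE.
apply/eqP; rewrite -(eqn_add2r (\sum_(e in H) ((e.1 \in X) && (e.2 \in X)))).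
rewrite -!big_split /=; apply/eqP.
transitivity (\sum_(e in H) (e.1 \in X)); last rewrite cutE.
  by apply: eq_bigr => e _; case: (e.1 \in X); case: (e.2 \in X).
by apply: eq_bigr => e _; case: (e.1 \in X); case: (e.2 \in X).
Qed.

(** A simple path from [y] to [x], closed by the arc [xy], is a cycle [c]; [next c] permutes its
    vertices, so each is the tail of one arc and the head of one. *)
Lemma cycle_through H x y :
  (x, y) \in H -> connect (arc_rel H) y x ->
  exists C : {set V * V},
    [/\ C \subset H, (x, y) \in C, balanced C & rooted C x].
Proof.
move=> xyH /connectP[p0 pth0 ex].
case: (shortenP pth0) ex => p pth Up _ ex.
pose c := y :: p.
have cycH : cycle (arc_rel H) c by rewrite /= rcons_path pth -ex.
have xc : x \in c by rewrite ex mem_last.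
have nextx : next c x = y.
  (* As [x] is the last entry of [c], the lookup in [p] runs past the end and returns the default
     [y]. *)
  by rewrite next_nth xc ex index_last //= nth_default.
pose f z := (z, next c z).
have injf : {in c &, injective f} by move=> z t _ _ [].
pose C := [set f z | z in c].
have nextC z : z \in c -> (z, next c z) \in C by move=> zc; exact: imset_f.
exists C; split.
- by apply/subsetP => _ /imsetP[z zc ->]; exact: (next_cycle cycH zc).
- by rewrite -nextx; exact: nextC.
- apply/balancedP => z; rewrite !big_imset //=.
  (* Shifting the index along the cycle turns the sum over tails into the sum over heads. *)
  rewrite [LHS](reindex_onto (next c) (prev c)) => [|i _]; last exact: next_prev.
  by apply: eq_bigl => i; rewrite mem_next prev_next // eqxx andbT.
- apply/forall_inP => z zC.
  have zc : z \in c.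
    case/supportP: zC => t /orP[] /imsetP[w wc [e1 e2]]; first by rewrite e1.
    by rewrite e2 -[_ \in _]/(next c w \in c) mem_next.
  have path_y t : t \in c -> connect (adj_rel C) y t.
    apply: path_connect.
    have /= := cycle_next Up; rewrite rcons_path => /andP[pn _].
    rewrite -/c in pn.
    have sub : {in c &, subrel (frel (next c)) (adj_rel C)}.
      by move=> u v uc _ /eqP <-; rewrite /adj_rel nextC.
    by apply: (sub_in_path sub) pn; apply/allP => u.
  apply: connect_trans (path_y _ zc).
  by rewrite adj_sym; exact: path_y.
Qed.

(** * Replacing an arc by a path through a new vertex *)

Definition reroute H s t x : {set V * V} := (s, x) |: ((x, t) |: H :\ (s, t)).

Lemma balanced_reroute H s t x :
  (s, t) \in H -> x \notin support H -> balanced H ->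
  balanced (reroute H s t x).
Proof.
move=> stH xS /balancedP bH; apply/balancedP => z.
have xtN : (x, t) \notin H by apply: contra xS; exact: support_fst.
have sxN : (s, x) \notin H by apply: contra xS; exact: support_snd.
have sx : s != x by apply: contraNneq xS => <-; exact: support_fst stH.
have := bH z; rewrite !(big_setD1 _ stH) /=.
have N1 : (x, t) \notin H :\ (s, t) by rewrite inE (negPf xtN) andbF.
have N2 : (s, x) \notin (x, t) |: H :\ (s, t).
  by rewrite !inE (negPf sxN) andbF orbF xpair_eqE (negPf sx).
by rewrite !(big_setU1 _ N2) /= !(big_setU1 _ N1) /= => bz; rewrite addnCA bz.
Qed.

Lemma support_reroute H s t x :
  (s, t) \in H -> x |: support H \subset support (reroute H s t x).
Proof.
move=> stH.
have sxR : (s, x) \in reroute H s t x by rewrite !inE eqxx.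
have xtR : (x, t) \in reroute H s t x by rewrite !inE eqxx orbT.
have inR u v : (u, v) \in H ->
    (u \in support (reroute H s t x)) && (v \in support (reroute H s t x)).
  move=> uvH; have [[-> ->]|uvst] := eqVneq (u, v) (s, t).
    by rewrite (support_fst sxR) (support_snd xtR).
  have uvR : (u, v) \in reroute H s t x by rewrite !inE uvst uvH !orbT.
  by rewrite (support_fst uvR) (support_snd uvR).
apply/subsetP => z /setU1P[->|/supportP[w /orP[] /inR/andP[]//]].
exact: support_snd sxR.
Qed.

(** The only lost adjacency, between [s] and [t], survives as a walk through [x]. *)
Lemma rooted_reroute H s t x r :
  (s, t) \in H -> rooted H r -> r \in support H -> rooted (reroute H s t x) r.
Proof.
move=> stH /forall_inP rH rS; set R := reroute H s t x.
have sxR : connect (adj_rel R) s x.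
  by apply: connect1; rewrite /adj_rel !inE eqxx.
have xtR : connect (adj_rel R) x t.
  by apply: connect1; rewrite /adj_rel !inE eqxx orbT.
have stR : connect (adj_rel R) s t := connect_trans sxR xtR.
have HR u v : connect (adj_rel H) u v -> connect (adj_rel R) u v.
  apply: connect_sub => {}u {}v.
  wlog uvH : u v / (u, v) \in H => [hw /orP[]uvH|_].
  - by apply: hw => //; rewrite /adj_rel uvH.
  - by rewrite adj_sym; apply: hw => //; rewrite /adj_rel uvH.
  have [[-> ->]//|uvst] := eqVneq (u, v) (s, t).
  by apply: connect1; rewrite /adj_rel !inE uvst uvH !orbT.
have rs : connect (adj_rel R) r s := HR _ _ (rH _ (support_fst stH)).
have rx := connect_trans rs sxR.
have rSR z : z \in support H -> connect (adj_rel R) r z.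
  by move=> zS; apply: HR; exact: rH.
have RSx u v : (u, v) \in R ->
    connect (adj_rel R) r u && connect (adj_rel R) r v.
  case/setU1P=> [[-> ->]|/setU1P[[-> ->]|/setD1P[_ uvH]]].
  - by rewrite rs rx.
  - by rewrite rx (connect_trans rx xtR).
  by rewrite !rSR ?(support_fst uvH) ?(support_snd uvH).
by apply/forall_inP => z /supportP[w /orP[] /RSx/andP[]].
Qed.

End ArcSets.

(** * Good arc sets and those of maximum support *)

Section Maximal.

Variables (V : finType) (D : digraph V) (a : V * V).

Definition good (H : {set V * V}) : bool :=
  [&& H \subset arcs D, a \in H, balanced H & rooted H a.1].

Lemma good_support (H : {set V * V}) : a \in H -> a.1 \in support H.
Proof. by case: a => u v; exact: support_fst. Qed.

(** The arc [xy] lies on a cycle arc-disjoint from [H] that meets its support in [x] or [y], so the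
    union stays balanced and connected. *)
Lemma good_cycle (H : {set V * V}) x y :
  good H -> (x \in support H) || (y \in support H) ->
  (x, y) \in arcs D :\: H -> connect (arc_rel (arcs D :\: H)) y x ->
  exists2 H', good H' & [/\ support H \subset support H',
                            x \in support H' & y \in support H'].
Proof.
case/and4P=> sHD aH bH rH xyS xyG yxG.
have [C [sCG xyC bC rC]] := cycle_through xyG yxG.
have sHU := subsetUl H C; have sCU := subsetUr H C.
have [xC yC] := (support_fst xyC, support_snd xyC).
exists (H :|: C); last by rewrite supportU subsetUl !(inE, xC, yC) !orbT.
have sCD : C \subset arcs D by apply: subset_trans sCG _; exact: subsetDl.
have dHC : [disjoint H & C].
  rewrite disjoint_sym disjoints_subset (subset_trans sCG) //.
  by apply/subsetP => e; rewrite !inE => /andP[].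
apply/and4P; split; first by rewrite subUset sHD.
- by rewrite inE aH.
- exact: balancedU.
have rHU z : z \in support H -> connect (adj_rel (H :|: C)) a.1 z.
  by move=> zS; apply: adj_connectS sHU _; move/forall_inP: rH; apply.
have rCU z : z \in support C -> connect (adj_rel (H :|: C)) x z.
  by move=> zS; apply: adj_connectS sCU _; move/forall_inP: rC; apply.
have ax : connect (adj_rel (H :|: C)) a.1 x.
  case/orP: xyS => [/rHU //|/rHU ay].
  by apply: connect_trans ay _; rewrite adj_sym; exact: rCU.
apply/forall_inP => z; rewrite supportU => /setUP[/rHU //|/rCU].
exact: connect_trans.
Qed.

Lemma good_reroute (H : {set V * V}) s t x :
  good H -> (s, t) \in H -> (s, t) != a -> x \notin support H ->
  (s, x) \in arcs D -> (x, t) \in arcs D -> good (reroute H s t x).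
Proof.
case/and4P=> sHD aH bH rH stH sta xS sxD xtD; apply/and4P; split.
- rewrite !subUset !sub1set sxD xtD /=.
  by apply: subset_trans sHD; exact: subsetDl.
- by rewrite !inE (eq_sym a (s, t)) sta aH !orbT.
- exact: balanced_reroute.
- by apply: rooted_reroute => //; exact: good_support.
Qed.

Hypotheses (D_semi : semicomplete D) (D_2as : arc_strong 2 D).
Hypothesis aD : a \in arcs D.

(** The form in which 2-arc-strength is used: a nonempty vertex set that no arc leaves, up to at
    most one deleted arc, is everything. *)
Lemma closed_reach (B : {set V * V}) (Z : {set V}) s t :
  B \subset arcs D -> #|B| < 2 -> s \in Z ->
  (forall y z, y \in Z -> (y, z) \in arcs D -> (y, z) \notin B -> z \in Z) ->
  t \in Z.
Proof.
move=> sBD cB sZ clZ; have [<- //|st] := eqVneq s t.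
have /connectP[p pth ->] := D_2as sBD cB st.
elim: p s sZ pth {st} => //= y p IHp s sZ /andP[sy]; apply: IHp.
by move: sy; rewrite /Defs.arc inE => /andP[syB syD]; exact: clZ sZ syD syB.
Qed.

Lemma ex_good : exists H, good H.
Proof.
have vu : connect (arc_rel (arcs D)) a.2 a.1.
  suff: a.1 \in [set z | connect (arc_rel (arcs D)) a.2 z] by rewrite inE.
  apply: (@closed_reach set0 _ a.2); rewrite ?sub0set ?cards0 ?inE //.
  move=> y z; rewrite !inE => vy yzD _.
  by apply: connect_trans vy _; exact: connect1.
have uvD : (a.1, a.2) \in arcs D by rewrite -surjective_pairing.
have [C [sCD uvC bC rC]] := cycle_through uvD vu.
by exists C; apply/and4P; split; rewrite // (surjective_pairing a).
Qed.

Lemma maximal_good_spanning (H : {set V * V}) :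
  good H -> (forall H', good H' -> #|support H'| <= #|support H|) ->
  forall x, x \in support H.
Proof.
move=> gH maxH x; apply/negPn/negP => xS.
have /and4P[sHD aH bH rH] := gH.
have maxS z H' : good H' -> support H \subset support H' ->
    z \notin support H -> z \notin support H'.
  move=> gH' sS zS; apply: contra zS => zS'.
  suff -> : support H = support H' by [].
  by apply/eqP; rewrite eqEcard sS maxH.
set S := support H in xS maxS *; pose G := arcs D :\: H.
(* Arcs of [H] have both ends in [S]. *)
have GE y z : (y, z) \in arcs D -> (y \notin S) || (z \notin S) -> (y, z) \in G.
  move=> yzD; rewrite in_setD yzD andbT; apply: contraL => yzH.
  by rewrite negb_or !negbK (support_fst yzH) (support_snd yzH).
have no_ear y z : (y, z) \in arcs D -> (y \in S) (+) (z \in S) ->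
    ~~ connect (arc_rel G) z y.
  move=> yzD yzS; apply/negP => zyG.
  have yzG : (y, z) \in G.
    by apply: GE yzD _; move: yzS; case: (y \in S); case: (z \in S).
  have yzS1 : (y \in S) || (z \in S).
    by move: yzS; case: (y \in S); case: (z \in S).
  have [H' gH' [sS' yS' zS']] := good_cycle gH yzS1 yzG zyG.
  have [yS|/(maxS y H' gH' sS')/negP//] := boolP (y \in S).
  have [zS|/(maxS z H' gH' sS')/negP//] := boolP (z \in S).
  by rewrite yS zS in yzS.
pose T := [set s | (s \in S) && ((x, s) \in arcs D)].
have TE s : (s \in T) = (s \in S) && ((x, s) \in arcs D) by rewrite in_set.
have inST s : s \in S -> s \notin T -> (s, x) \in arcs D.
  move=> sS; rewrite TE sS /= => xsN.
  have sx : s != x by apply: contraNneq xS => <-.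
  by have := D_semi sx; rewrite /Defs.arc (negPf xsN) orbF.
have aS : a.1 \in S := good_support aH.
have [T0|[t0 t0T]] := set_0Vmem T.
  (* Every vertex of [S] now has an arc to [x], so [no_ear] keeps [Z] outside [S]; arcs of [D]
     starting there all lie in [G], hence [Z] is closed in [D]. *)
  pose Z := [set z | connect (arc_rel G) x z].
  have ZE z : (z \in Z) = connect (arc_rel G) x z by rewrite in_set.
  have ZS s : s \in S -> s \notin Z.
    move=> sS; rewrite ZE; apply: no_ear; last by rewrite sS (negPf xS).
    by apply: inST; rewrite // T0 in_set0.
  suff: a.1 \in Z by apply/negP; exact: ZS.
  apply: (@closed_reach set0 _ x); rewrite ?sub0set ?cards0 ?ZE //.
  move=> y z yZ yzD _.
  have yS : y \notin S by apply: contraL yZ; exact: ZS.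
  move: yZ; rewrite !ZE => xy; apply: connect_trans xy _; apply: connect1.
  by apply: GE; rewrite // yS.
pose B := [set e in H | (e.1 \in T) && (e.2 \notin T)].
have cB : #|B| < 2.
  (* Count the arcs of [H] entering [T] instead: rerouting any of them other than [a] through [x]
     would enlarge the support. *)
  rewrite balanced_cut // ltnS -(cards1 a); apply/subset_leq_card/subsetP.
  case=> s t; rewrite in_set in_set1 /= => /and3P[stH sT].
  rewrite TE => /andP[tS xtD]; apply/negPn/negP => sta.
  have sS : s \in S := support_fst stH.
  have sxD : (s, x) \in arcs D := inST s sS sT.
  have gR := good_reroute gH stH sta xS sxD xtD.
  have := support_reroute x stH; rewrite subUset sub1set => /andP[xR sR].
  by have := maxS x _ gR sR xS; rewrite xR.
pose Z := [set z | [exists t in T, connect (arc_rel G) t z]].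
have ZP z : reflect (exists2 t, t \in T & connect (arc_rel G) t z) (z \in Z).
  by rewrite in_set; exact: exists_inP.
have xZ : x \notin Z.
  apply/ZP => -[t]; rewrite TE => /andP[tS xtD]; apply/negP; apply: no_ear => //.
  by rewrite tS (negPf xS).
have ZG y z : y \in Z -> (y, z) \in G -> z \in Z.
  move=> /ZP[t tT ty] yzG; apply/ZP; exists t => //.
  exact: connect_trans ty (connect1 yzG).
have ZT s : s \in S -> s \in Z -> s \in T.
  (* Otherwise the arc [sx], which is in [G], would bring [x] into [Z]. *)
  move=> sS sZ; apply: contraNT xZ => sT; apply: ZG sZ _.
  by apply: GE; rewrite ?xS ?orbT // inST.
have TZ t : t \in T -> t \in Z by move=> tT; apply/ZP; exists t.
move/negP: xZ; apply; apply: (@closed_reach B _ t0) => //; last first.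
(* Arcs of [G] stay in [Z] by reachability; an arc of [H] starting in [Z] has its tail in [T], and
   being outside [B] it also ends in [T]. *)
- move=> y z yZ yzD yzB; have [yzH|yzN] := boolP ((y, z) \in H); last first.
    by apply: ZG yZ _; rewrite in_setD yzN.
  have yT : y \in T by apply: ZT yZ; exact: support_fst yzH.
  by apply: TZ; move: yzB; rewrite in_set yzH yT /= negbK.
- exact: TZ.
- by apply: subset_trans sHD; apply/subsetP => e; rewrite in_set => /andP[].
Qed.

End Maximal.

Theorem theorem4 (V : finType) (D : digraph V)
    (D_semicomplete : semicomplete D) (D_2arc_strong : arc_strong 2 D)
    (a : V * V) (a_arc : a \in arcs D) :
  exists H : digraph V,
    [/\ spanning_subdigraph H D, eulerian H & a \in arcs H].
Proof.
have [H0 gH0] := ex_good D_2arc_strong a_arc.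
case: (arg_maxnP (fun H => #|support H|) gH0) => H gH maxH.
have spanH := maximal_good_spanning D_semicomplete D_2arc_strong gH maxH.
have /and4P[sHD aH /balancedP bH /forall_inP rH] := gH.
have loopless x : (x, x) \notin H.
  by apply: contra (arcs_loopless D x); exact: (subsetP sHD).
exists (Digraph loopless); split=> //; split=> [s t|x].
  (* The support is all of [V], so any two vertices are joined through the tail of [a]. *)
  have rt : connect (adj_rel H) a.1 t := rH t (spanH t).
  by apply: connect_trans rt; rewrite adj_sym; exact: rH.
by rewrite /in_degree /out_degree -[RHS]sum_fst_deg bH sum_snd_deg.
Qed.
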